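(* Let $(G,c,o)$ be a recurrent rooted network whose edge resistances $r_e=1/c_e$ are bounded, $\sup_{e\in E}r_e<\infty$, and let $h$ be a potential on $(G,c,o)$. Then there exists an exhaustion $\{D_n\}$ of $G$, with $\lim_{n\to\infty}h_n(v)=h(v)$ for all $v\in V$, such that for every $v_1\in S_h$ the network random walks started at $v_1$ and conditioned to exit $D_n$ before reaching $o$ (that is, conditioned on $\tau_{D_n^c}<\tau_o$) converge weakly, as $n\to\infty$, to the $h$-process started at $v_1$.
   Context: A network $(G,c)$ is an infinite, connected, locally finite graph $G=(V,E)$ with positive edge weights (conductances) $c_{xy}=c_{yx}$, $xy\in E$; put $c_x=\sum_{z\sim x}c_{xz}$. The network random walk $\{X_n\}$ is the Markov chain on $V$ with transition probabilities $p(x,y)=c_{xy}/c_x$ for $x\sim y$; $\mathbb{P}_x$ is its law started at $x$. The network is recurrent if this walk is recurrent. A rooted network $(G,c,o)$ is a network with a distinguished vertex $o\in V$. The Laplacian of $f:V\to\mathbb{R}$ is $\Delta f(v)=\sum_{x\sim v}c_{vx}(f(x)-f(v))$. A potential on $(G,c,o)$ is a function $h:V\to[0,\infty)$ with $h(o)=0$, $\Delta h(o)=1$ and $\Delta h(v)=0$ for every $v\ne o$. For a potential $h$, the $h$-process is the Markov chain on $S_h=\{v:h(v)>0\}$ with transition probabilities $p^h(x,y)=p(x,y)h(y)/h(x)$. For a set $B\subset V$, $\tau_B=\min\{n\ge0:X_n\in B\}$, and $\tau_o=\tau_{\{o\}}$. An exhaustion of $G$ is a sequence of finite sets $D_n\subset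 V$ with $o\in D_n\subset D_{n+1}$ and $\bigcup_nD_n=V$. Given an exhaustion, $\mathsf{g}_n(x,y)=\frac1{c_y}\sum_{k\ge0}\mathbb{P}_x(X_k=y,\ \tau_{D_n^c}>k)$ and $h_n(x)=\mathsf{g}_n(o,o)-\mathsf{g}_n(x,o)$. Weak convergence of processes means weak convergence of the laws of trajectories in the product topology, i.e. convergence of the probability that the initial segment equals $\gamma$, for every finite path $\gamma$. *)

(* Defs.v *)
From mathcomp Require Import all_boot all_order all_algebra.
From mathcomp Require Import all_classical all_reals all_analysis.

Set Implicit Arguments.
Unset Strict Implicit.
Unset Printing Implicit Defensive.

Import Order.TTheory GRing.Theory Num.Theory.
Import numFieldNormedType.Exports.

Local Open Scope classical_set_scope.
Local Open Scope ring_scope.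

(* Loops are allowed: [adj] is not required to be irreflexive.  The values of
   [cond] off the edges are irrelevant, since [cond] is only used on edges. *)
Record network (R : realType) (V : choiceType) := Network {
  adj : rel V;
  cond : V -> V -> R;
  adj_sym : forall x y, adj x y = adj y x;
  cond_sym : forall x y, adj x y -> cond x y = cond y x;
  cond_gt0 : forall x y, adj x y -> 0 < cond x y;
  net_infinite : infinite_set [set: V];
  net_connected : forall x y, exists2 s : seq V, path adj x s & last x s = y;
  net_locally_finite : forall x, finite_set [set y | adj x y] }.

Section Network.
Variables (R : realType) (V : choiceType) (N : network R V).

Definition vcond (x : V) : R := \sum_(z \in [set z | adj N x z]) cond N x z.

Definition trans (x y : V) : R :=
  if adj N x y then cond N x y / vcond x else 0.

Definition laplacian (f : V -> R) (v : V) : R :=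
  \sum_(x \in [set x | adj N v x]) cond N v x * (f x - f v).

Definition potential (o : V) (h : V -> R) : Prop :=
  [/\ forall v, 0 <= h v, h o = 0, laplacian h o = 1
    & forall v, v != o -> laplacian h v = 0].

Definition bounded_resistances : Prop :=
  has_ubound [set (cond N e.1 e.2)^-1 | e in [set e : V * V | adj N e.1 e.2]].

Definition posset (h : V -> R) := {v : V | 0 < h v}.

Definition htrans (h : V -> R) (x y : posset h) : R :=
  trans (val x) (val y) * h (val y) / h (val x).

End Network.

Definition exhaustion (V : Type) (o : V) (D : nat -> set V) : Prop :=
  [/\ forall n, finite_set (D n), forall n, D n o,
      forall n, D n `<=` D n.+1 & \bigcup_n D n = setT].

Section Process.
Variables (R : realType) (d : measure_display) (Omega : measurableType d).
Variable T : Type.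
Implicit Types (P : probability Omega R) (X : nat -> Omega -> T).

(* The event that the initial segment of the trajectory is the finite path
   [s], listed as X_0, ..., X_(size s - 1). *)
Definition initial_segment X (s : seq T) : set Omega :=
  [set w | mkseq (fun i => X i w) (size s) = s].

(* [X] is under [P] a Markov chain on the discrete space [T], started at [x],
   with transition probabilities [q]; the last clause is the Markov property
   P(X_(k+1) = z | X_0, ..., X_k = s, y) = q y z, with the denominator cleared
   so that paths of probability 0 need no separate treatment. *)
Definition markov_chain (q : T -> T -> R) (x : T) P X : Prop :=
  [/\ forall n (A : set T), measurable (X n @^-1` A),
      P (X 0%N @^-1` [set x]) = 1%E
    & forall (s : seq T) (y z : T),
        P (initial_segment X (rcons (rcons s y) z)) =
        (P (initial_segment X (rcons s y)) * (q y z)%:E)%E].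

(* The infimum of the empty set is +oo: [B] is never hit. *)
Definition hitting_time X (B : set T) (w : Omega) : \bar R :=
  ereal_inf [set n%:R%:E | n in [set n : nat | B (X n w)]].

Definition recurrent_chain (P : T -> probability Omega R) X : Prop :=
  forall x, P x [set w | exists2 n, (0 < n)%N & X n w = x] = 1%E.

(* Equal to 0 when [P B = 0], as division by 0 returns 0. *)
Definition cond_prob P (A B : set Omega) : R :=
  fine (P (A `&` B)) / fine (P B).

End Process.

Section Green.
Variables (R : realType) (V : choiceType) (N : network R V).
Variables (d : measure_display) (Omega : measurableType d).
Variables (P : V -> probability Omega R) (X : nat -> Omega -> V).

Definition green (D : set V) (x y : V) : \bar R :=
  ((vcond N y)^-1%:E *
   \sum_(0 <= k <oo)
     P x [set w | X k w = y /\ (k%:R%:E < hitting_time R X (~` D) w)%E])%E.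

Definition hgreen (o : V) (D : set V) (x : V) : \bar R :=
  (green D o o - green D x o)%E.

End Green.

(* Main.v *)
Require Import Defs.
From mathcomp Require Import all_boot all_order all_algebra.
From mathcomp Require Import all_classical all_reals all_analysis.
From mathcomp Require Import finmap ring lra.
Import Order.TTheory GRing.Theory Num.Theory.
Import numFieldNormedType.Exports.
Local Open Scope classical_set_scope.
Local Open Scope ring_scope.

(* Idea.  Fix L > 0 and a finite set D = {h < L} `&` B, with B a large ball
   around the root [o].  Summing the laplacian of min(h, h y) by parts against
   the probability of hitting [o] before leaving a large ball, which tends to 1
   by recurrence, shows that the current of [h] along any edge is at most 1;
   bounded resistances then give |h x - h y| <= C along edges, so [h] lies in
   [L, L + C] where the walk leaves {h < L}.  Let q x be the probability of
   leaving D before hitting [o] from [x].  By the maximum principle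
   h <= (L + C) q and L q <= h + L (1 - e), where e, the probability of hitting
   [o] before leaving B, is as close to 1 as we like.  Since h_D is the multiple
   of q with unit flux at [o], it is h up to a factor 1 + O(1/L); this gives
   the exhaustion.  The walk conditioned to exit D before reaching [o] is the
   Doob transform of the walk by q, hence by h_D, whose path probabilities
   converge to those of the h-process. *)

(** * Averages and the maximum principle *)

Section Averages.
Set Implicit Arguments.
Unset Strict Implicit.
Unset Printing Implicit Defensive.
Variables (R : realType) (V : choiceType) (N : network R V).

Definition nb (x : V) : {fset V} := fset_set [set y | adj N x y].

Lemma mem_nb x y : (y \in nb x) = adj N x y.
Proof.
rewrite in_fset_set; last exact: net_locally_finite.
by apply/idP/idP => [/set_mem|xy]; [|exact: mem_set].
Qed.

Lemma fsbig_nb (F : V -> R) x :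
  \sum_(y \in [set y | adj N x y]) F y = \sum_(y <- nb x) F y.
Proof. by rewrite fsbig_finite//; exact: net_locally_finite. Qed.

Lemma connected_ind (A : V -> Prop) x : A x ->
  (forall u v, A u -> adj N u v -> A v) -> forall y, A y.
Proof.
move=> Ax AS y; have [s + <-] := net_connected N x y.
elim: s x Ax => [//|z s IH] x Ax /= /andP[xz zs].
by apply: IH zs; exact: AS xz.
Qed.

(** A vertex without neighbours would, by connectedness, be the only vertex, against
    [net_infinite]. *)
Lemma vcond_gt0 x : 0 < vcond N x.
Proof.
rewrite /vcond fsbig_nb lt_neqAle.
have ge0 : 0 <= \sum_(y <- nb x) cond N x y.
  rewrite big_seq; apply: sumr_ge0 => y; rewrite mem_nb => /cond_gt0.
  exact: ltW.
rewrite ge0 andbT eq_sym; apply/negP => /eqP s0.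
apply: (net_infinite N); apply: sub_finite_set (finite_set1 x) => y _.
apply: (@connected_ind (fun y => y = x) x) => // u v ->{u} xv.
exfalso; move: s0; rewrite (big_fsetD1 v) ?mem_nb//=.
apply/eqP; rewrite gt_eqF// ltr_wpDr ?cond_gt0//.
rewrite big_seq; apply: sumr_ge0 => y'; rewrite !inE mem_nb => /andP[_].
by move=> /cond_gt0/ltW.
Qed.

Definition avg (f : V -> R) x := \sum_(y <- nb x) trans N x y * f y.

Lemma trans_ge0 x y : 0 <= trans N x y.
Proof.
rewrite /trans; case: ifP => // xy.
by rewrite divr_ge0// ltW// ?vcond_gt0// cond_gt0.
Qed.

Lemma trans_gt0 x y : adj N x y -> 0 < trans N x y.
Proof. by move=> xy; rewrite /trans xy divr_gt0// ?vcond_gt0// cond_gt0. Qed.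

Lemma vcondM_trans x y : adj N x y -> vcond N x * trans N x y = cond N x y.
Proof. by move=> xy; rewrite /trans xy mulrC divfK// gt_eqF// vcond_gt0. Qed.

Lemma sum_trans x : \sum_(y <- nb x) trans N x y = 1.
Proof.
apply: (mulfI (lt0r_neq0 (vcond_gt0 x))); rewrite mulr1 mulr_sumr.
rewrite [RHS]/vcond fsbig_nb; apply: eq_big_seq => y; rewrite mem_nb.
exact: vcondM_trans.
Qed.

Lemma avg_cst c x : avg (fun=> c) x = c.
Proof. by rewrite /avg -mulr_suml sum_trans mul1r. Qed.

Lemma avgB f g x : avg (fun y => f y - g y) x = avg f x - avg g x.
Proof.
rewrite /avg -sumrB; apply: eq_bigr => y _; exact: mulrBr.
Qed.

Lemma avgD f g x : avg (fun y => f y + g y) x = avg f x + avg g x.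
Proof.
rewrite /avg -big_split; apply: eq_bigr => y _; exact: mulrDr.
Qed.

Lemma avgZ c f x : avg (fun y => c * f y) x = c * avg f x.
Proof. by rewrite /avg mulr_sumr; apply: eq_bigr => y _; rewrite mulrCA. Qed.

Lemma avg_le f g x : (forall y, adj N x y -> f y <= g y) -> avg f x <= avg g x.
Proof.
move=> fg; rewrite /avg big_seq [leRHS]big_seq; apply: ler_sum => y.
by rewrite mem_nb => /fg; apply: ler_wpM2l; exact: trans_ge0.
Qed.

Lemma laplacianE f x : laplacian N f x = vcond N x * (avg f x - f x).
Proof.
rewrite -[X in _ - X](avg_cst (f x) x) -avgB /laplacian fsbig_nb mulr_sumr.
by apply: eq_big_seq => y; rewrite mem_nb => xy; rewrite mulrA vcondM_trans.
Qed.

Lemma avg_eq0 f x : (forall y, adj N x y -> 0 <= f y) -> avg f x <= 0 ->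
  forall y, adj N x y -> f y = 0.
Proof.
move=> f0 af y xy.
have t0 z : z \in nb x -> 0 <= trans N x z * f z.
  by rewrite mem_nb => xz; rewrite mulr_ge0 ?trans_ge0 ?f0.
have /eqP : trans N x y * f y == 0.
  rewrite eq_le mulr_ge0 ?trans_ge0 ?f0// andbT; apply: le_trans af.
  rewrite /avg (big_fsetD1 y) ?mem_nb//= lerDl big_seq; apply: sumr_ge0 => z.
  by rewrite !inE => /andP[_ /t0].
by move/eqP; rewrite mulf_eq0 gt_eqF ?trans_gt0//= => /eqP.
Qed.

(** A zero is a minimum, so averaging spreads it to all neighbours and then over the connected
    graph. *)
Lemma nonneg_harmonic_eq0 f x : (forall y, 0 <= f y) -> (forall y, avg f y = f y) ->
  f x = 0 -> forall y, f y = 0.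
Proof.
move=> f0 af fx; apply: (connected_ind (x := x)) => // u v fu uv.
by apply: (avg_eq0 (x := u)) => //; rewrite af fu.
Qed.

(** A positive maximum over [S] would spread along edges without ever leaving [S], since [f <= 0]
    just outside; then the infinite vertex set would be contained in the finite set [S]. *)
Lemma max_principle (S : set V) f : finite_set S ->
  (forall x, S x -> f x <= avg f x) ->
  (forall x y, S x -> adj N x y -> ~ S y -> f y <= 0) ->
  forall x, S x -> f x <= 0.
Proof.
move=> finS sub bd x Sx; rewrite leNgt; apply/negP => fx.
have xS : x \in fset_set S by rewrite in_fset_set//; exact: mem_set.
case: (@arg_maxP _ _ _ [` xS]%fset xpredT (fun i => f (val i))) => //.
move=> m _ maxm.
have fm : 0 < f (val m) by apply: lt_le_trans (maxm [` xS]%fset _).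
have maxS y : S y -> f y <= f (val m).
  move=> Sy; have yS : y \in fset_set S by rewrite in_fset_set//; exact: mem_set.
  exact: (maxm [` yS]%fset).
have Sm : S (val m) by move: (valP m); rewrite in_fset_set// => /set_mem.
have all_S y : S y /\ f y = f (val m).
  pose A y := S y /\ f y = f (val m).
  apply: (connected_ind (A := A) (x := val m)); first by split.
  move=> u v [Su fu] uv.
  have fv : f (val m) - f v = 0.
    apply: (avg_eq0 (x := u) (f := fun v => f (val m) - f v)) => //.
      move=> z uz; rewrite subr_ge0; have [Sz|nSz] := pselect (S z).
        exact: maxS.
      exact: le_trans (bd _ _ Su uz nSz) (ltW fm).
    by rewrite avgB avg_cst subr_le0 -fu sub.
  have fvm : f v = f (val m) by apply/esym/eqP; rewrite -subr_eq0 fv.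
  split=> //; apply: contrapT => nSv.
  by have := bd _ _ Su uv nSv; rewrite fvm leNgt fm.
apply: (net_infinite N); apply: sub_finite_set finS => y _.
by have [] := all_S y.
Qed.

End Averages.

(** * The gradient bound *)

Section Gradient.
Set Implicit Arguments.
Unset Strict Implicit.
Unset Printing Implicit Defensive.
Variables (R : realType) (V : choiceType) (N : network R V).

(* [e] will be the probability of hitting [o] before leaving the finite set
   [B]. *)
Definition hits_root_before_exit (o : V) (B : set V) (e : V -> R) : Prop :=
  [/\ e o = 1, forall x, 0 <= e x <= 1, forall x, ~ B x -> e x = 0
    & forall x, B x -> x != o -> avg N e x = e x].

(* Summation by parts: the sum equals [\sum_x f x * laplacian e x], where
   [f o = 0] and the laplacian of [e] vanishes on [B] off [o] and is
   nonnegative outside [B]. *)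
Lemma sum_laplacian_ge0 o (B : set V) e f : finite_set B ->
  hits_root_before_exit o B e ->
  (forall x, 0 <= f x) -> f o = 0 ->
  0 <= \sum_(x <- fset_set B) e x * laplacian N f x.
Proof.
move=> finB [eo e01 e0 harm] f0 fo.
(* Adding the neighbours of [B] and extending the weights by 0 off the edges puts the whole
   computation on one finite set [F], where the weights [w] are symmetric and the two summations can
   be exchanged. *)
have finF : finite_set (B `|` \bigcup_(x in B) [set y | adj N x y]).
  rewrite finite_setU; split => //; apply: bigcup_finite => // x _.
  exact: net_locally_finite.
set F := fset_set (B `|` \bigcup_(x in B) [set y | adj N x y]).
pose w x y : R := if adj N x y then cond N x y else 0.
have wC x y : w x y = w y x.
  rewrite /w [adj N y x]adj_sym; case: ifP => // xy; exact: cond_sym.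
have w0 x y : 0 <= w x y by rewrite /w; case: ifP => // /cond_gt0/ltW.
have lapF g x : B x -> laplacian N g x = \sum_(y <- F) w x y * (g y - g x).
  move=> Bx; rewrite /laplacian fsbig_nb.
  transitivity (\sum_(y <- nb N x) w x y * (g y - g x)).
    by apply: eq_big_seq => y; rewrite mem_nb /w => ->.
  apply: big_fset_incl.
    apply/fsubsetP => y; rewrite mem_nb in_fset_set// => xy.
    by apply: mem_set; right; exists x.
  by move=> y _; rewrite mem_nb /w => /negbTE ->; rewrite mul0r.
rewrite (_ : \sum_(x <- _) _ =
    \sum_(x <- F) f x * \sum_(y <- F) w x y * (e y - e x)).
  rewrite big_seq; apply: sumr_ge0 => x _.
  have [Bx|nBx] := pselect (B x).
    rewrite -lapF//; have [->|xo] := eqVneq x o; first by rewrite fo mul0r.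
    by rewrite laplacianE harm// subrr mulr0 mulr0.
  (* Off [B] the sum over [F] may miss neighbours of [x], so it need not be the Laplacian; but
     [e x = 0] there, and every term is nonnegative. *)
  rewrite mulr_ge0// sumr_ge0// => y _.
  by rewrite mulr_ge0// (e0 _ nBx) subr0; case/andP: (e01 y).
transitivity (\sum_(x <- F) e x * \sum_(y <- F) w x y * (f y - f x)).
  rewrite (eq_big_seq (fun x => e x * \sum_(y <- F) w x y * (f y - f x))); last first.
    by move=> x; rewrite in_fset_set// => /set_mem Bx; rewrite lapF.
  apply: big_fset_incl.
    by rewrite -fset_set_sub// => x Bx; left.
  move=> x _; rewrite in_fset_set// => /negP xB.
  by rewrite e0 ?mul0r// => Bx; apply: xB; exact: mem_set.
transitivity (\sum_(x <- F) \sum_(y <- F) w x y * (e x * f y)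
   - \sum_(x <- F) \sum_(y <- F) w x y * (e x * f x)).
  rewrite -sumrB; apply: eq_bigr => x _; rewrite mulr_sumr -sumrB.
  by apply: eq_bigr => y _; ring.
rewrite exchange_big -sumrB; apply: eq_bigr => x _; rewrite mulr_sumr -sumrB.
by apply: eq_bigr => y _; rewrite wC; ring.
Qed.

Variables (o : V) (h : V -> R).
Hypothesis pot : potential N o h.

Lemma potential_avg x : x != o -> avg N h x = h x.
Proof.
move=> xo; have [_ _ _ /(_ x xo)/eqP] := pot.
by rewrite laplacianE mulf_eq0 gt_eqF ?vcond_gt0//= subr_eq0 => /eqP.
Qed.

Lemma potential_avg_root : vcond N o * avg N h o = 1.
Proof. by have [_ h0 lap _] := pot; rewrite -lap laplacianE h0 subr0. Qed.

(* The current along an edge is at most the unit current leaving the root: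
   truncate [h] at the height of [y] and sum by parts. *)
Lemma potential_gradient_approx B e x y : finite_set B -> B o ->
  hits_root_before_exit o B e ->
  adj N x y -> e y * (cond N x y * (h y - h x)) <= 1.
Proof.
move=> finB Bo eP xy; have [h0 ho _ _] := pot.
have [eo e01 e0 harm] := eP.
have cxy := cond_gt0 xy.
have [hyx|hxy] := leP (h y) (h x).
  apply: le_trans ler01; have /andP[ey _] := e01 y.
  by rewrite mulr_ge0_le0// mulr_ge0_le0 ?subr_le0// ltW.
pose f v := Num.min (h v) (h y).
have f0 v : 0 <= f v by rewrite /f le_min !h0.
have fo : f o = 0 by rewrite /f ho min_l.
have yo : y != o by apply: contraTneq hxy => ->; rewrite ho -leNgt.
have avgf v : avg N f v <= Num.min (avg N h v) (h y).
  rewrite le_min; apply/andP; split; first by apply: avg_le => z _; rewrite ge_min lexx.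
  by rewrite -[leRHS](avg_cst N _ v); apply: avg_le => z _; rewrite ge_min lexx orbT.
have lapf v : v != o -> laplacian N f v <= 0.
  move=> vo; rewrite laplacianE pmulr_rle0 ?vcond_gt0// subr_le0.
  by apply: le_trans (avgf v) _; rewrite potential_avg.
have lapfo : laplacian N f o <= 1.
  rewrite laplacianE fo subr0 -potential_avg_root ler_pM2l ?vcond_gt0//.
  by apply: le_trans (avgf o) _; rewrite ge_min lexx.
(* At [y] the truncation attains its cap, so no edge contributes a positive amount, and the edge to
   [x] already gives the bound. *)
have lapfy : laplacian N f y <= - (cond N x y * (h y - h x)).
  rewrite /laplacian fsbig_nb (big_fsetD1 x) ?mem_nb 1?adj_sym//=.
  have -> : f y = h y by rewrite /f minxx.
  have -> : f x = h x by rewrite /f min_l// ltW.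
  rewrite -(cond_sym xy) -[leRHS]addr0 lerD//; first by rewrite -mulrN opprB.
  rewrite big_seq; apply: sumr_le0 => z; rewrite !inE mem_nb => /andP[_ yz].
  rewrite mulr_ge0_le0//; first exact/ltW/cond_gt0.
  by rewrite subr_le0 ge_min lexx orbT.
have [By|/e0 ->] := pselect (B y); last by rewrite mul0r.
have := sum_laplacian_ge0 finB eP f0 fo.
have oB : o \in fset_set B by rewrite in_fset_set//; exact: mem_set.
have yB : y \in (fset_set B `\ o)%fset.
  by rewrite !inE yo in_fset_set//; exact: mem_set.
(* The root contributes at most 1, the vertex [y] at most minus the weighted current, and all other
   vertices at most 0; the total is nonnegative. *)
rewrite (big_fsetD1 o)//= (big_fsetD1 y)//= eo mul1r.
set s := \sum_(_ <- _) _.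
have : s <= 0.
  rewrite /s big_seq; apply: sumr_le0 => z; rewrite !inE => /and3P[_ zo _].
  by rewrite mulr_ge0_le0 ?lapf//; case/andP: (e01 z).
have : e y * laplacian N f y <= - (e y * (cond N x y * (h y - h x))).
  by rewrite -mulrN ler_wpM2l//; case/andP: (e01 y).
move: lapfo; lra.
Qed.

End Gradient.

(** * Hitting probabilities as sums over the hitting time *)

Section HittingSums.
Set Implicit Arguments.
Unset Strict Implicit.
Unset Printing Implicit Defensive.
Variables (R : realType) (V : choiceType) (N : network R V).
Implicit Types (S B : set V) (f W : V -> R).

Definition killed_avg S f x : R := if x \in S then avg N f x else 0.

(* The probability, for the walk started at [x], that
   X_0, ..., X_(n - 1) lie in [S] and X_n lies in [B]. *)
Definition hit_at S B n : V -> R := iter n (killed_avg S) (\1_B).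

(** For disjoint [S] and [B] at most one term can occur on a trajectory, and this is the probability
    of hitting [B] in time. When [B] is contained in [S] it is an expected number of visits; the
    Green function is obtained in that way. *)
Definition hit_before S B n x : R := \sum_(k < n) hit_at S B k x.

Definition hit S B x : R := limn (fun n => hit_before S B n x).

Lemma killed_avgT S f x : S x -> killed_avg S f x = avg N f x.
Proof. by move=> /mem_set Sx; rewrite /killed_avg Sx. Qed.

Lemma killed_avgF S f x : ~ S x -> killed_avg S f x = 0.
Proof. by move=> Sx; rewrite /killed_avg memNset. Qed.

Lemma killed_avg_le S f g x : (forall y, f y <= g y) ->
  killed_avg S f x <= killed_avg S g x.
Proof. by move=> fg; rewrite /killed_avg; case: ifP => // _; exact: avg_le. Qed.

Lemma hit_at_ge0 S B n x : 0 <= hit_at S B n x.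
Proof.
elim: n x => [|n IH] x /=; first by rewrite /hit_at /= indicE.
apply: le_trans (killed_avg_le S x IH).
by rewrite /killed_avg avg_cst; case: ifP.
Qed.

Lemma hit_beforeS S B n x :
  hit_before S B n.+1 x = \1_B x + killed_avg S (hit_before S B n) x.
Proof.
rewrite /hit_before big_ord_recl /=; congr (_ + _).
rewrite (eq_bigr (fun k : 'I_n => killed_avg S (hit_at S B k) x))//.
rewrite /killed_avg /avg; case: ifP => xS; last by rewrite big1.
by rewrite exchange_big; apply: eq_bigr => y _; rewrite mulr_sumr.
Qed.

Lemma hit_before_nd S B x :
  {homo (fun n => hit_before S B n x) : m n / (m <= n)%N >-> m <= n}.
Proof.
apply/nondecreasing_seqP => n; rewrite /hit_before big_ord_recr /= lerDl.
exact: hit_at_ge0.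
Qed.

(** By induction on time a supersolution dominates all partial sums [hit_before]. Exhibiting one is
    what makes the real limit [hit] converge, and [hit] then lies below it. *)
Definition supersolution S B W : Prop :=
  (forall x, 0 <= W x) /\ forall x, \1_B x + killed_avg S W x <= W x.

Lemma hit_before_le S B W n x : supersolution S B W -> hit_before S B n x <= W x.
Proof.
move=> [W0 sW]; elim: n x => [|n IH] x.
  by rewrite /hit_before big_ord0.
rewrite hit_beforeS; apply: le_trans (sW x).
by rewrite lerD2l; exact: killed_avg_le.
Qed.

Section Supersolution.
Variables (S B : set V) (W : V -> R).
Hypothesis sW : supersolution S B W.

Lemma hit_before_cvg x : hit_before S B n x @[n --> \oo] --> hit S B x.
Proof.
apply: nondecreasing_is_cvgn; first exact: hit_before_nd.
by exists (W x) => _ [n _ <-]; exact: hit_before_le.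
Qed.

Lemma hit_le x : hit S B x <= W x.
Proof.
apply: limr_le; first exact: hit_before_cvg.
by apply: nearW => n; exact: hit_before_le.
Qed.

Lemma hit_before_le_hit n x : hit_before S B n x <= hit S B x.
Proof.
by apply: nondecreasing_cvgn_le; [exact: hit_before_nd|exact: hit_before_cvg].
Qed.

Lemma hit_ge0 x : 0 <= hit S B x.
Proof. by have := hit_before_le_hit 0 x; rewrite {1}/hit_before big_ord0. Qed.

Lemma hitE x : hit S B x = \1_B x + killed_avg S (hit S B) x.
Proof.
apply: (cvg_unique _ (F := fmap (fun n => hit_before S B n.+1 x) \oo)) => //.
  by have := @hit_before_cvg x; rewrite -cvg_shiftS.
rewrite (_ : (fun n => _) = fun n => \1_B x + killed_avg S (hit_before S B n) x);
  last by apply/funext => n; exact: hit_beforeS.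
apply: cvgD; first exact: cvg_cst.
rewrite /killed_avg; case: ifP => _; last exact: cvg_cst.
apply: cvg_big => [|y _]; first exact: add_continuous.
 apply: cvgM; [exact: cvg_cst|exact: hit_before_cvg].
Qed.

End Supersolution.

Lemma disjoint_supersolution S B : S `&` B = set0 ->
  supersolution S B (fun=> 1).
Proof.
move=> SB; split => // x; rewrite /killed_avg avg_cst indicE.
case: ifPn => [/set_mem Sx|_]; last by rewrite addr0; case: (x \in B).
rewrite memNset ?add0r// => Bx.
by have : (S `&` B) x by []; rewrite SB.
Qed.

End HittingSums.

(** * The exhaustion *)

Section Exhaustion.
Set Implicit Arguments.
Unset Strict Implicit.
Unset Printing Implicit Defensive.
Variables (R : realType) (V : choiceType) (N : network R V) (o : V).

Definition exit_prob (D : set V) : V -> R := hit N (D `\ o) (~` D).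

Definition root_prob (B : set V) : V -> R := hit N (B `\ o) [set o].

Fixpoint nball n : set V :=
  if n is m.+1 then nball m `|` \bigcup_(x in nball m) [set y | adj N x y]
  else [set o].

Lemma finite_nball n : finite_set (nball n).
Proof.
elim: n => [|n IH] //=; rewrite finite_setU; split => //.
by apply: bigcup_finite => // x _; exact: net_locally_finite.
Qed.

Lemma subset_nball m n : (m <= n)%N -> nball m `<=` nball n.
Proof.
elim: n => [|n IH]; first by rewrite leqn0 => /eqP ->.
by rewrite leq_eqVlt ltnS => /predU1P[->//|/IH mn] x /mn xn; left.
Qed.

Lemma nball_adj n x y : nball n x -> adj N x y -> nball n.+1 y.
Proof. by move=> nx xy; right; exists x. Qed.

Lemma nball_root n : nball n o.
Proof. exact: (@subset_nball 0). Qed.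

Lemma nball_cover x : exists n, nball n x.
Proof.
apply: (connected_ind (N := N) (A := fun x => exists n, nball n x) (x := o)).
  by exists 0%N.
by move=> u v [n nu] uv; exists n.+1; exact: nball_adj uv.
Qed.

Section ExitProb.
Variable D : set V.
Hypothesis Do : D o.

Lemma exit_supersolution : supersolution N (D `\ o) (~` D) (fun=> 1).
Proof.
by apply: disjoint_supersolution; apply/seteqP; split => x // [[Dx _] /(_ Dx)].
Qed.

Lemma exit_prob_bounds x : 0 <= exit_prob D x <= 1.
Proof.
apply/andP; split; [exact: hit_ge0 exit_supersolution _|].
exact: hit_le exit_supersolution _.
Qed.

Lemma exit_prob_root : exit_prob D o = 0.
Proof.
rewrite /exit_prob (hitE exit_supersolution) indicE memNset; last exact.
by rewrite add0r killed_avgF// => -[_]; exact.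
Qed.

Lemma exit_prob_out x : ~ D x -> exit_prob D x = 1.
Proof.
move=> Dx; rewrite /exit_prob (hitE exit_supersolution) indicE mem_set//.
by rewrite killed_avgF ?addr0// => -[].
Qed.

Lemma exit_prob_harmonic x : D x -> x != o -> exit_prob D x = avg N (exit_prob D) x.
Proof.
move=> Dx /eqP xo; rewrite {1}/exit_prob (hitE exit_supersolution) indicE.
by rewrite memNset ?add0r ?killed_avgT//; exact.
Qed.

Lemma root_supersolution : supersolution N (D `\ o) [set o] (fun=> 1).
Proof.
by apply: disjoint_supersolution; apply/seteqP; split => x // [[_]].
Qed.

Lemma root_prob_root : root_prob D o = 1.
Proof.
rewrite /root_prob (hitE root_supersolution) indicE mem_set//.
by rewrite killed_avgF ?addr0// => -[_]; exact.
Qed.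

Lemma root_prob_harmonic x : D x -> x != o -> avg N (root_prob D) x = root_prob D x.
Proof.
move=> Dx /eqP xo; rewrite {2}/root_prob (hitE root_supersolution) indicE.
by rewrite memNset// add0r killed_avgT.
Qed.

Lemma root_probP : hits_root_before_exit N o D (root_prob D).
Proof.
split.
- exact: root_prob_root.
- move=> x; apply/andP; split; [exact: hit_ge0 root_supersolution _|].
  exact: hit_le root_supersolution _.
- move=> x Dx; rewrite /root_prob (hitE root_supersolution) indicE memNset.
    by rewrite add0r killed_avgF// => -[].
  by move=> xo; apply: Dx; rewrite xo.
- exact: root_prob_harmonic.
Qed.

End ExitProb.

(** One minus the hitting probability is nonnegative, vanishes at [o] and is harmonic off [o]; the
    hypothesis makes it harmonic at [o] as well, so it vanishes everywhere. *)
Lemma hit_eq1 : avg N (hit N (~` [set o]) [set o]) o = 1 ->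
  forall x, hit N (~` [set o]) [set o] x = 1.
Proof.
have sup : supersolution N (~` [set o]) [set o] (fun=> 1).
  by apply: disjoint_supersolution; rewrite setICl.
have hitx x : x != o -> hit N (~` [set o]) [set o] x =
    avg N (hit N (~` [set o]) [set o]) x.
  move=> /eqP xo; rewrite {1}(hitE sup) indicE memNset// add0r killed_avgT//.
have hito : hit N (~` [set o]) [set o] o = 1.
  by rewrite (hitE sup) indicE mem_set// killed_avgF ?addr0//; apply.
move=> avgo x; apply/esym/eqP; rewrite -subr_eq0; apply/eqP; move: x.
apply: (nonneg_harmonic_eq0 (N := N) (x := o)) => [x|x|].
- by rewrite subr_ge0; exact: (hit_le sup).
- rewrite avgB avg_cst; have [->|xo] := eqVneq x o; first by rewrite avgo hito.
  by rewrite -hitx.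
- by rewrite hito subrr.
Qed.

Hypothesis recurrent : forall x, hit N (~` [set o]) [set o] x = 1.

(** Within [k] steps from the ball of radius [r] the walk stays in the ball of radius [r + k], so
    killing it outside [nball m] changes nothing. *)
Lemma hit_at_nball r m k x : nball r x -> (r + k <= m)%N ->
  hit_at N (nball m `\ o) [set o] k x = hit_at N (~` [set o]) [set o] k x.
Proof.
elim: k r x => [//|k IH] r x rx rkm; rewrite /hit_at /= -!/(hit_at _ _ _ k).
have mx : nball m x by apply: subset_nball rx; apply: leq_trans rkm; exact: leq_addr.
have [->|/eqP xo] := eqVneq x o; first by rewrite !killed_avgF//; [exact|case=> _; exact].
rewrite !killed_avgT//; apply: eq_big_seq => y; rewrite mem_nb => xy.
by congr (_ * _); apply: (IH r.+1); [exact: nball_adj xy|rewrite addSnnS].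
Qed.

(** By recurrence [o] is hit within some [n] steps with probability at least [1 - e], and in a large
    enough ball these [n] steps cannot reach the boundary. *)
Lemma root_prob_cvg1 x e : 0 < e ->
  exists M, forall m, (M <= m)%N -> 1 - e <= root_prob (nball m) x.
Proof.
move=> e0; have sup : supersolution N (~` [set o]) [set o] (fun=> 1).
  by apply: disjoint_supersolution; rewrite setICl.
have [r rx] := nball_cover x.
have [n _ /(_ n (leqnn n)) /= hn] :
    \forall n \near \oo, 1 - e <= hit_before N (~` [set o]) [set o] n x.
  have cvgx := @hit_before_cvg _ _ _ _ _ _ sup x.
  by apply: (cvgr_ge _ cvgx); rewrite recurrent ltrBlDr ltrDl.
exists (r + n)%N => m rnm; apply: le_trans hn _.
apply: le_trans (hit_before_le_hit (root_supersolution (nball m)) n x).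
apply: ler_sum => k _; rewrite (hit_at_nball rx)//.
by apply: leq_trans rnm; rewrite leq_add2l ltnW.
Qed.

Lemma root_prob_cvg1_seq (s : seq V) e : 0 < e -> exists M, forall m, (M <= m)%N ->
  forall x, x \in s -> 1 - e <= root_prob (nball m) x.
Proof.
move=> e0; elim: s => [|x s [M HM]]; first by exists 0%N.
have [M' HM'] := root_prob_cvg1 x e0.
exists (maxn M M') => m; rewrite geq_max => /andP[Mm M'm] y.
by rewrite inE => /predU1P[->|ys]; [exact: HM'|exact: HM].
Qed.

Variable h : V -> R.
Hypothesis pot : potential N o h.

(** As the ball grows, the factor [e y] in [potential_gradient_approx] tends to 1. *)
Lemma potential_gradient x y : adj N x y -> cond N x y * (h y - h x) <= 1.
Proof.
move=> xy; set c := cond N x y * _.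
have [c0|c0] := leP c 0; first exact: le_trans c0 ler01.
rewrite leNgt; apply/negP => c1.
(* This tolerance gives [root_prob (nball M) y * c >= (c + 1) / 2], which exceeds 1 when [c]
   does. *)
have [|M /(_ M (leqnn M)) eM] := @root_prob_cvg1 y (2^-1 * (1 - c^-1)).
  by rewrite mulr_gt0// subr_gt0 invf_lt1.
have := potential_gradient_approx pot (finite_nball M) (nball_root M)
  (root_probP (nball_root M)) xy.
rewrite -/c leNgt => /negP; apply.
have : (1 - 2^-1 * (1 - c^-1)) * c <= root_prob (nball M) y * c by rewrite ler_wpM2r// ltW.
apply: lt_le_trans.
have -> : (1 - 2^-1 * (1 - c^-1)) * c = (c + 1) / 2.
  by field; rewrite gt_eqF.
lra.
Qed.

(** * Comparing the potential with the exit probability of a truncated ball *)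

Section Truncation.
Variables (C L : R) (B : set V).
Hypothesis gradC : forall x y, adj N x y -> h y <= h x + C.
Hypotheses (C0 : 0 <= C) (L0 : 0 < L) (finB : finite_set B) (Bo : B o).

Let D := [set x | h x < L] `&` B.
Let q := exit_prob D.
Let e := root_prob B.

Let Do : D o. Proof. by split => //=; have [_ -> _ _] := pot. Qed.

Let finD : finite_set D. Proof. exact: finite_setIr. Qed.

Let finDo : finite_set (D `\ o). Proof. exact: finite_setD. Qed.

Let h0 x : 0 <= h x. Proof. by have [] := pot. Qed.

Let ho : h o = 0. Proof. by have [] := pot. Qed.

Lemma potential_le_exit_prob x : D x -> h x <= (L + C) * q x.
Proof.
move=> Dx; have [->|xo] := eqVneq x o; first by rewrite ho /q exit_prob_root// mulr0.
rewrite -subr_le0; apply: (max_principle (N := N) (S := D `\ o)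
    (f := fun x => h x - (L + C) * q x)) => //.
- move=> y [Dy /eqP yo]; rewrite avgB avgZ (potential_avg pot yo).
  by rewrite -exit_prob_harmonic.
(* Whether [z] lies above level [L] or outside [B], the step came from [y] with [h y < L], so
   [h z <= L + C] in both cases. *)
- move=> y z [[/= hy _] _] yz /not_andP[Dz|/contrapT ->]; last first.
    by rewrite ho /q exit_prob_root// mulr0 subrr.
  rewrite subr_le0 /q exit_prob_out// mulr1.
  by apply: le_trans (gradC yz) _; rewrite lerD2r ltW.
- by split => //; exact/eqP.
Qed.

(** An exit through level [L] is paid for by [h]. An exit through the boundary of [B], where [h] may
    be small, is paid for by [L * (1 - e x)], because [e] vanishes outside [B]. *)
Lemma exit_prob_le_potential x : L * q x <= h x + L * (1 - e x).
Proof.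
have [eo e01 e0 harm] := root_probP Bo.
have out y : ~ D y -> L * q y <= h y + L * (1 - e y).
  move=> nDy; rewrite /q exit_prob_out// mulr1.
  move/not_andP: nDy => [/negP|/e0 ey]; last by rewrite /e ey subr0 mulr1 lerDr.
  rewrite /= -leNgt => Lh; apply: le_trans Lh _; rewrite lerDl mulr_ge0//; first exact: ltW.
  by rewrite subr_ge0; case/andP: (e01 y).
have at_root : L * q o <= h o + L * (1 - e o).
  by rewrite /q exit_prob_root// ho /e eo subrr mulr0 addr0.
have [Dx|/out//] := pselect (D x).
have [->//|xo] := eqVneq x o.
rewrite -subr_le0; apply: (max_principle (N := N) (S := D `\ o)
    (f := fun x => L * q x - (h x + L * (1 - e x)))) => //.
- move=> y [Dy /eqP yo]; have [_ By] := Dy.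
  rewrite avgB avgD !avgZ avgB avg_cst (potential_avg pot yo) (harm _ By yo).
  by rewrite -exit_prob_harmonic.
- move=> y z _ _ /not_andP[Dz|/contrapT ->]; rewrite subr_le0//; exact: out.
- by split => //; exact/eqP.
Qed.

(* [q / a] has laplacian 1 at [o]: it is h_D. *)
Let a := vcond N o * avg N q o.

(** The bound [potential_le_exit_prob] is averaged over the neighbours of [o], where [h] has unit
    flux. A neighbour outside [D] has [q = 1] and [h <= C]. *)
Lemma flux_lower : 1 <= (L + C) * a.
Proof.
rewrite -(potential_avg_root pot) /a mulrCA ler_pM2l ?vcond_gt0// -avgZ.
apply: avg_le => x ox; have [Dx|nDx] := pselect (D x).
  exact: potential_le_exit_prob.
rewrite /q exit_prob_out// mulr1; apply: le_trans (gradC ox) _.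
by rewrite ho add0r lerDr ltW.
Qed.

Variable eps : R.
Hypothesis epsP : forall x, adj N o x -> L * (1 - e x) <= eps.

Lemma flux_upper : L * a <= 1 + vcond N o * eps.
Proof.
rewrite -(potential_avg_root pot) /a mulrCA -mulrDr ler_pM2l ?vcond_gt0// -avgZ.
rewrite -[eps in leRHS](avg_cst N eps o) -avgD; apply: avg_le => x ox.
apply: le_trans (exit_prob_le_potential x) _; rewrite lerD2l; exact: epsP.
Qed.

(** Each bound on [q] is combined with the matching bound on the flux [a]. The correction factors
    tend to 1 as [L] grows and [eps] tends to 0. *)
Lemma truncation_bounds x : D x -> L * (1 - e x) <= eps ->
  [/\ 0 < a, q x / a <= (h x + eps) * (1 + C / L)
    & h x <= q x / a * ((1 + C / L) * (1 + vcond N o * eps))].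
Proof.
move=> Dx ex; have LC0 : 0 < L + C by rewrite ltr_wpDr.
have a0 : 0 < a.
  by rewrite -(pmulr_rgt0 _ LC0); apply: lt_le_trans flux_lower.
have q0 : 0 <= q x by case/andP: (exit_prob_bounds D x).
have LE : 1 + C / L = (L + C) / L by field; rewrite gt_eqF.
split=> //.
- rewrite LE ler_pdivrMr// -(ler_pM2r L0).
  rewrite [leRHS](_ : _ = (h x + eps) * ((L + C) * a)); last first.
    by field; rewrite gt_eqF.
  have hx : q x * L <= h x + eps.
    by rewrite mulrC; apply: le_trans (exit_prob_le_potential x) _; rewrite lerD2l.
  apply: le_trans (hx) _; rewrite ler_peMr ?flux_lower//.
  by apply: le_trans hx; rewrite mulr_ge0// ltW.
- apply: le_trans (potential_le_exit_prob Dx) _.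
  rewrite [leRHS](_ : _ = (L + C) * q x * ((1 + vcond N o * eps) / (L * a))).
    apply: ler_peMr; first by rewrite mulr_ge0// ltW.
    by rewrite (ler_pdivlMr _ _ (mulr_gt0 L0 a0)) mul1r flux_upper.
  by field; rewrite !gt_eqF.
Qed.

End Truncation.

Lemma potential_exhaustion : bounded_resistances N ->
  exists D, [/\ exhaustion o D,
    \forall n \near \oo, 0 < vcond N o * avg N (exit_prob (D n)) o
  & forall v, exit_prob (D n) v / (vcond N o * avg N (exit_prob (D n)) o)
      @[n --> \oo] --> h v].
Proof.
move=> [C0 HC]; pose C := `|C0|.
have gradC x y : adj N x y -> h y <= h x + C.
  move=> xy; rewrite -lerBlDl; have cxy := cond_gt0 xy.
  apply: le_trans (_ : (cond N x y)^-1 <= _).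
    by rewrite -div1r ler_pdivlMr// mulrC potential_gradient.
  by apply: le_trans (ler_norm _); apply: HC; exists (x, y).
(* At level [L = n.+1] the error [L * (1 - e)] should be at most [n.+1%:R^-1] on [nball n], so the
   root must be hit with probability within [n.+1%:R^-1 ^+ 2] of 1. *)
have [f Hf] : {f : nat -> nat & forall n m, (f n <= m)%N ->
    forall x, nball n x -> n.+1%:R * (1 - root_prob (nball m) x) <= n.+1%:R^-1}.
  apply: (@choice _ _ (fun n M => forall m, (M <= m)%N ->
    forall x, nball n x -> n.+1%:R * (1 - root_prob (nball m) x) <= n.+1%:R^-1)) => n.
  have [|M HM] := @root_prob_cvg1_seq (fset_set (nball n)) (n.+1%:R^-1 ^+ 2).
    by rewrite exprn_gt0.
  exists M => m /HM Hm x nx; rewrite mulrC -ler_pdivlMr// -expr2 lerBlDr -lerBlDl.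
  by apply: Hm; rewrite in_fset_set; [exact: mem_set|exact: finite_nball].
(* The partial sums of [f] make the radii monotone and at least [f n]; the summand [n] makes the
   balls cover [V]. *)
pose M n := (n + \sum_(k < n.+1) f k)%N.
have MS n : (M n <= M n.+1)%N.
  by rewrite /M [in leqRHS]big_ord_recr/= leq_add// leq_addr.
have fM n : (f n <= M n)%N by rewrite /M big_ord_recr /= addnA leq_addl.
pose D n := [set x | h x < n.+1%:R] `&` nball (M n).
have [h0 ho _ _] := pot.
have subD n : D n `<=` D n.+1.
  move=> x [/= hx Mx]; split; last exact: subset_nball Mx.
  by apply: lt_trans hx _; rewrite ltr_nat.
have coverD x : \forall n \near \oo, D n x.
  have [r rx] := nball_cover x.
  near=> n; split => /=.
    have : h x < n%:R by near: n; exact: nbhs_infty_gtr.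
    by move=> hx; apply: lt_trans hx _; rewrite ltr_nat.
  apply: subset_nball rx; apply: leq_trans (leq_addr _ _).
  by near: n; exact: nbhs_infty_ge.
(* The condition [0 < n] puts the neighbours of [o] in [nball n], where the error is controlled; the
   flux estimate uses it there. *)
have bounds n x : (0 < n)%N -> nball n x -> D n x ->
  let a := vcond N o * avg N (exit_prob (D n)) o in
  [/\ 0 < a, exit_prob (D n) x / a <= (h x + n.+1%:R^-1) * (1 + C / n.+1%:R)
    & h x <= exit_prob (D n) x / a *
        ((1 + C / n.+1%:R) * (1 + vcond N o * n.+1%:R^-1))].
  move=> n0 nx Dx; apply: truncation_bounds => //.
  - exact: normr_ge0.
  - exact: finite_nball.
  - exact: nball_root.
  - move=> y oy; apply: Hf (fM n) _ _; apply: (@subset_nball 1) => //.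
    exact: nball_adj oy.
  - exact: Hf (fM n) _ nx.
have bounds_near x : \forall n \near \oo, [/\ (0 < n)%N, nball n x & D n x].
  have [r rx] := nball_cover x.
  near=> n; split; first by near: n; exact: nbhs_infty_gt.
    by apply: subset_nball rx; near: n; exact: nbhs_infty_ge.
  by near: n; exact: coverD.
exists D; split.
- split=> //.
  + by move=> n; apply: finite_setIr; exact: finite_nball.
  + by move=> n; split; [rewrite /= ho|exact: nball_root].
  + apply/seteqP; split => // x _; have [n _ /(_ n (leqnn n)) Dx] := coverD x.
    by exists n.
- near=> n; have [n0 no Dno] : [/\ (0 < n)%N, nball n o & D n o].
    by near: n; exact: bounds_near.
  by have [] := bounds _ _ n0 no Dno.
- move=> x; pose eta n : R := n.+1%:R^-1.
  have eta0 : eta n @[n --> \oo] --> 0 by exact: cvg_harmonic.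
  pose lo n := h x / ((1 + C * eta n) * (1 + vcond N o * eta n)).
  pose up n := (h x + eta n) * (1 + C * eta n).
  have one_plus c : 1 + c * eta n @[n --> \oo] --> (1 : R).
    rewrite -[X in _ --> X]addr0 -(mulr0 c).
    by apply: cvgD; [exact: cvg_cst|apply: cvgM; [exact: cvg_cst|]].
  apply: (@squeeze_cvgr _ _ _ _ lo up).
  + near=> n; have [n0 nx Dx] : [/\ (0 < n)%N, nball n x & D n x].
      by near: n; exact: bounds_near.
    have [_ upx lox] := bounds _ _ n0 nx Dx.
    apply/andP; split => //; rewrite /lo ler_pdivrMr//.
    have pos c : 0 <= c -> 0 < 1 + c * eta n.
      by move=> c0; rewrite ltr_wpDr// mulr_ge0// invr_ge0.
    by apply: mulr_gt0; apply: pos; [exact: normr_ge0|exact: ltW (vcond_gt0 N o)].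
  + rewrite -[X in _ --> X]divr1 -[X in _ / X]mulr1; apply: cvgM; first exact: cvg_cst.
    by apply: cvgV; [rewrite mulr1 oner_neq0|apply: cvgM].
  + rewrite -[X in _ --> X]mulr1 -[X in X * _]addr0; apply: cvgM => //.
    by apply: cvgD => //; exact: cvg_cst.
Unshelve. all: by end_near.
Qed.


End Exhaustion.

(** * Path events *)

Section Segments.
Set Implicit Arguments.
Unset Strict Implicit.
Unset Printing Implicit Defensive.
Variables (R : realType) (d : measure_display) (Omega : measurableType d).
Variable T : eqType.
Implicit Types (P : probability Omega R) (X : nat -> Omega -> T).

Lemma initial_segment_nil X : initial_segment X [::] = setT.
Proof. by apply/seteqP. Qed.

Lemma initial_segment_rcons X s y :
  initial_segment X (rcons s y) = initial_segment X s `&` X (size s) @^-1` [set y].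
Proof.
apply/seteqP; split=> w; rewrite /initial_segment /= size_rcons.
  rewrite mkseqS => /eqP; rewrite eqseq_rcons => /andP[/eqP sw /eqP yw].
  by split.
by case=> sw yw; rewrite mkseqS sw yw.
Qed.

Lemma initial_segment_nth X s w i x0 : initial_segment X s w ->
  (i < size s)%N -> X i w = nth x0 s i.
Proof. by move=> sw ilt; rewrite -[s in RHS]sw nth_mkseq. Qed.

Variables (q : T -> T -> R) (x : T) (P : probability Omega R).
Variable X : nat -> Omega -> T.
Hypothesis chain : markov_chain q x P X.

Lemma measurable_state n (A : set T) : measurable (X n @^-1` A).
Proof. by have [] := chain. Qed.

Lemma measurable_segment s : measurable (initial_segment X s).
Proof.
elim/last_ind: s => [|s y IH]; first by rewrite initial_segment_nil.
rewrite initial_segment_rcons; apply: measurableI => //.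
exact: measurable_state.
Qed.

Lemma prob_segment1 y : P (initial_segment X [:: y]) = (y == x)%:R%:E.
Proof.
have [_ Px _] := chain.
have -> : initial_segment X [:: y] = X 0%N @^-1` [set y].
  by rewrite (initial_segment_rcons X [::]) initial_segment_nil setTI.
have [->|yx] := eqVneq y x; first by rewrite Px.
apply/eqP; rewrite eq_le measure_ge0 andbT.
have : (P (X 0%N @^-1` [set y]) <= P (~` (X 0%N @^-1` [set x])))%E.
  apply: le_measure; first by apply: mem_set; exact: measurable_state.
    by apply: mem_set; apply: measurableC; exact: measurable_state.
  by move=> w /= ->; exact/eqP.
by rewrite probability_setC ?Px ?subee//; exact: measurable_state.
Qed.

(** Prefixing the almost sure segment [[:: x]] brings an arbitrary event within reach of the Markov
    property, which is stated for nonempty paths. *)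
Lemma prob_start (A : set Omega) : measurable A ->
  P (initial_segment X [:: x] `&` A) = P A.
Proof.
move=> mA; have mS := measurable_segment [:: x].
rewrite [in RHS](_ : A = (initial_segment X [:: x] `&` A) `|`
    (~` initial_segment X [:: x] `&` A)); last first.
  by rewrite -setIUl setUv setTI.
rewrite measureU.
- rewrite [X in (_ + X)%E](_ : _ = 0%E) ?adde0//.
  apply/eqP; rewrite eq_le measure_ge0 andbT.
  apply: le_trans (_ : (P (~` initial_segment X [:: x]) <= _)%E).
    apply: le_measure; last exact: subIsetl.
      by apply: mem_set; apply: measurableI => //; exact: measurableC.
    by apply: mem_set; exact: measurableC.
  by rewrite probability_setC// prob_segment1 eqxx subee.
- exact: measurableI.
- by apply: measurableI => //; exact: measurableC.
- by rewrite setIACA setICr set0I.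
Qed.

End Segments.

(** * Hitting times read along a trajectory *)

Section HittingTime.
Set Implicit Arguments.
Unset Strict Implicit.
Unset Printing Implicit Defensive.
Variables (R : realType) (d : measure_display) (Omega : measurableType d).
Variables (T : Type) (X : nat -> Omega -> T).

Lemma hitting_time_gt (B : set T) w k :
  (k%:R%:E < hitting_time R X B w)%E <-> forall i, (i <= k)%N -> ~ B (X i w).
Proof.
split=> [kB i ik Bi|nB].
  have : (hitting_time R X B w <= i%:R%:E)%E by apply: ereal_inf_lbound; exists i.
  by apply/negP; rewrite -ltNge; apply: le_lt_trans kB; rewrite lee_fin ler_nat.
(* A strict lower bound need not survive an infimum; since times are integers, every hit occurs at
   [k.+1] or later, and this weak bound does survive. *)
apply: (@lt_le_trans _ _ k.+1%:R%:E); first by rewrite lte_fin ltr_nat.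
apply: le_ereal_inf_tmp => _ [n Bn <-]; rewrite lee_fin ler_nat ltnNge.
by apply/negP => /nB.
Qed.

Lemma hitting_time_lt (A B : set T) w :
  (hitting_time R X A w < hitting_time R X B w)%E <->
  exists n, [/\ A (X n w), forall i, (i < n)%N -> ~ A (X i w)
    & forall i, (i <= n)%N -> ~ B (X i w)].
Proof.
split=> [/ereal_inf_lt[_ [n An <-] /hitting_time_gt nB]|[n [An _ /hitting_time_gt]]].
  (* The infimum only yields some visit to [A] before [B]; the first visit is needed. *)
  have exA : exists n, `[< A (X n w) >] by exists n; exact/asboolP.
  case: (ex_minnP exA) => m /asboolP Am minm; exists m; split=> // i im.
    by move=> /asboolP/minm; rewrite leqNgt im.
  by apply: nB; apply: leq_trans im _; apply: minm; exact/asboolP.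
by apply: le_lt_trans; apply: ereal_inf_lbound; exists n.
Qed.

End HittingTime.

(** * Probabilities of path events for the network walk *)

Section Walk.
Set Implicit Arguments.
Unset Strict Implicit.
Unset Printing Implicit Defensive.
Variables (R : realType) (V : choiceType) (N : network R V).
Variables (d : measure_display) (Omega : measurableType d).
Variables (P : V -> probability Omega R) (X : nat -> Omega -> V).
Hypothesis walk : forall x, markov_chain (trans N) x (P x) X.

Lemma measurable_walk n (A : set V) (x : V) : measurable (X n @^-1` A).
Proof. exact: (measurable_state (walk x)). Qed.

Lemma measurable_walk_segment (x : V) s : measurable (initial_segment X s).
Proof. exact: (measurable_segment (walk x)). Qed.

Lemma prob_fin x A : measurable A -> P x A \is a fin_num.
Proof. exact: fin_num_measure. Qed.

Lemma prob_step_in (x y : V) k (A : set Omega) : measurable A ->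
  P x (A `&` X k @^-1` [set z | adj N y z]) =
  \sum_(z <- nb N y) P x (A `&` X k @^-1` [set z]).
Proof.
move=> mA; have fin := net_locally_finite N y.
rewrite -(fsbig_finite _ _ fin) -measure_fin_bigcup//.
- congr (P x _); rewrite -setI_bigcupr; congr (_ `&` _).
  apply/seteqP; split=> [w /= yw|w [z yz /= ->]//]; by exists (X k w).
- by move=> z z' _ _ [w [[_ /= <-] [_ /= <-]]].
- move=> z _; apply: measurableI => //; exact: measurable_walk x.
Qed.

(** The transition probabilities from [y] to its finitely many neighbours sum to 1, so the next
    vertex is almost surely one of them and the event splits accordingly. *)
Lemma prob_step x s y (A : set Omega) : measurable A ->
  P x (initial_segment X (rcons s y) `&` A) =
  \sum_(z <- nb N y) P x (initial_segment X (rcons (rcons s y) z) `&` A).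
Proof.
move=> mA; set S := initial_segment X (rcons s y).
have mS : measurable S by exact: (measurable_walk_segment x).
pose E := X (size (rcons s y)) @^-1` [set z | adj N y z].
have mE : measurable E by exact: (measurable_walk _ _ x).
have segE z : S `&` X (size (rcons s y)) @^-1` [set z] =
    initial_segment X (rcons (rcons s y) z).
  by rewrite [in RHS]initial_segment_rcons.
have SE : P x (S `&` E) = P x S.
  rewrite prob_step_in//.
  transitivity (\sum_(z <- nb N y) P x S * (trans N y z)%:E)%E.
    by apply: eq_bigr => z _; rewrite segE; have [_ _ ->] := walk x.
  rewrite -(fineK (prob_fin x mS)).
  under eq_bigr do rewrite -EFinM.
  by rewrite sumEFin -mulr_sumr sum_trans mulr1.
have splitE A' : measurable A' -> P x A' = (P x (A' `&` E) + P x (A' `&` ~` E))%E.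
  move=> mA'; rewrite -[in LHS](setIT A') -(setUv E) setIUr measureU//.
  - exact: measurableI.
  - by apply: measurableI => //; exact: measurableC.
  - by rewrite setIACA setICr setI0.
have S0 : P x (S `&` ~` E) = 0%E.
  have := splitE _ mS; rewrite SE => /(congr1 (fun u => u - P x S)%E).
  by rewrite subee ?prob_fin// addeAC subee ?prob_fin// add0e => ->.
have mSA : measurable (S `&` A) by exact: measurableI.
rewrite (splitE _ mSA) [X in (_ + X)%E](_ : _ = 0%E) ?adde0.
  rewrite prob_step_in//; apply: eq_bigr => z _; congr (P x _).
  by rewrite -segE setIAC.
apply/eqP; rewrite eq_le measure_ge0 andbT -S0; apply: le_measure.
- by apply: mem_set; apply: measurableI => //; exact: measurableC.
- by apply: mem_set; apply: measurableI => //; exact: measurableC.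
- by move=> w [[Sw _] Ew].
Qed.

(** The clock starts at time [k]. With [k = size s] this is the time of the last vertex of
    [rcons s y], so the event describes the future of that path. *)
Definition hit_event (S B : set V) n k : set Omega :=
  [set w | (forall i, (i < n)%N -> S (X (k + i) w)) /\ B (X (k + n) w)].

Lemma measurable_hit_event S B n k (x : V) : measurable (hit_event S B n k).
Proof.
rewrite (_ : hit_event S B n k =
  \bigcap_(i in [set i | (i < n)%N]) (X (k + i) @^-1` S) `&` X (k + n) @^-1` B).
  apply: measurableI; last exact: (measurable_walk _ _ x).
  by apply: bigcap_measurableType => // i _; exact: (measurable_walk _ _ x).
by apply/seteqP; split.
Qed.

(** This is the Markov property for an event of the future, by induction on its length through
    [prob_step]. *)
Lemma prob_hit_event x s y S B n :
  P x (initial_segment X (rcons s y) `&` hit_event S B n (size s)) =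
  (P x (initial_segment X (rcons s y)) * (hit_at N S B n y)%:E)%E.
Proof.
have at_y s' y' w : initial_segment X (rcons s' y') w -> X (size s') w = y'.
  by rewrite initial_segment_rcons => -[].
elim: n s y => [|n IH] s y.
  rewrite /hit_at /= indicE; have [By|nBy] := pselect (B y).
    rewrite mem_set// mule1; congr (P x _); apply: setIidl => w /at_y Xw.
    by split => //; rewrite addn0 Xw.
  rewrite memNset// mule0 -(measure0 (P x)); congr (P x _).
  by apply/seteqP; split=> // w [/at_y Xw [_]]; rewrite addn0 Xw.
have mE : measurable (hit_event S B n.+1 (size s)) by exact: (measurable_hit_event _ _ _ _ x).
rewrite /hit_at /= -/(hit_at _ _ _ n); have [Sy|nSy] := pselect (S y); last first.
  rewrite killed_avgF// mule0 -(measure0 (P x)); congr (P x _).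
  apply/seteqP; split=> // w [/at_y Xw [/(_ 0%N (ltn0Sn n))]].
  by rewrite addn0 Xw.
rewrite prob_step// killed_avgT//.
rewrite (eq_bigr (fun z => P x (initial_segment X (rcons s y)) *
    (trans N y z * hit_at N S B n z)%:E)%E); last first.
  (* Once the path is extended by [z], the event of length [n.+1] started at [y] becomes the event
     of length [n] started one unit later; its first requirement holds as [y] is in [S]. *)
  move=> z _; have [_ _ chain] := walk x; rewrite EFinM muleA -chain -IH.
  congr (P x _); apply/seteqP; rewrite !initial_segment_rcons !size_rcons.
  split=> w [[[sw Xw] Xw'] [SE BE]]; split => //; split.
  - by move=> i ilt; rewrite addSnnS; exact: SE.
  - by rewrite addSnnS.
  - case=> [_|i ilt]; first by rewrite addn0 Xw.
    by rewrite -addSnnS; exact: SE.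
  - by rewrite -addSnnS.
rewrite -(fineK (prob_fin x (measurable_walk_segment x (rcons s y)))).
under eq_bigr do rewrite -EFinM.
by rewrite sumEFin -mulr_sumr -EFinM.
Qed.

Lemma prob_hit_event0 x S B n : P x (hit_event S B n 0) = (hit_at N S B n x)%:E.
Proof.
rewrite -(prob_start (walk x)); last exact: (measurable_hit_event _ _ _ _ x).
by rewrite (prob_hit_event x [::]) (prob_segment1 (walk x)) eqxx mul1e.
Qed.

Lemma hit_series S B W x : supersolution N S B W ->
  (\sum_(0 <= n <oo) (hit_at N S B n x)%:E)%E = (hit N S B x)%:E.
Proof.
move=> sup; rewrite /hit -EFin_lim; last exact: cvgP (@hit_before_cvg _ _ _ _ _ _ sup x).
congr (limn _); apply/funext => n /=.
by rewrite sumEFin /hit_before big_mkord.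
Qed.

Lemma trivIset_hit_event S B k : S `&` B = set0 ->
  trivIset setT (fun n => hit_event S B n k).
Proof.
move=> SB; have lt_disj m n w : (m < n)%N -> hit_event S B m k w ->
    hit_event S B n k w -> False.
  move=> mn [_ Bm] [/(_ m mn) Sm _].
  by have : (S `&` B) (X (k + m) w) by []; rewrite SB.
move=> m n _ _ [w [mw nw]]; case: (ltngtP m n) => // mn; exfalso.
  exact: lt_disj mn mw nw.
exact: lt_disj mn nw mw.
Qed.

Lemma measurable_ever_hit S B k (x : V) : measurable (\bigcup_n hit_event S B n k).
Proof. by apply: bigcup_measurable => n _; exact: (measurable_hit_event _ _ _ _ x). Qed.

(** For disjoint [S] and [B] the events with different [n] exclude each other, so their
    probabilities add up to the series defining [hit]. *)
Lemma prob_ever_hit x s y S B : S `&` B = set0 ->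
  P x (initial_segment X (rcons s y) `&` \bigcup_n hit_event S B n (size s)) =
  (P x (initial_segment X (rcons s y)) * (hit N S B y)%:E)%E.
Proof.
move=> SB; have mS := measurable_walk_segment x (rcons s y).
have mE n : measurable (initial_segment X (rcons s y) `&` hit_event S B n (size s)).
  by apply: measurableI => //; exact: (measurable_hit_event _ _ _ _ x).
rewrite setI_bigcupr measure_semi_bigcup//.
- transitivity (\sum_(0 <= n <oo)
      (P x (initial_segment X (rcons s y)) * (hit_at N S B n y)%:E))%E.
    by apply: eq_eseriesr => n _; exact: prob_hit_event.
  rewrite -(fineK (prob_fin x mS)) nneseriesZl ?(hit_series _ (disjoint_supersolution N SB))//.
  by move=> n _; rewrite lee_fin hit_at_ge0.
- by apply: trivIset_setIl; exact: trivIset_hit_event.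
- exact: bigcup_measurable.
Qed.

(** The return to [o] is a hit by the walk with its clock started at time 1. Splitting by the first
    step shows that the hitting probability has average 1 around [o], and [hit_eq1] applies. *)
Lemma recurrent_hit o : recurrent_chain P X ->
  forall x, hit N (~` [set o]) [set o] x = 1.
Proof.
move=> rec; apply: hit_eq1; have := rec o.
have SB : ~` [set o] `&` [set o] = set0 by rewrite setICl.
have -> : [set w | exists2 n, (0 < n)%N & X n w = o] =
    \bigcup_n hit_event (~` [set o]) [set o] n 1.
  apply/seteqP; split=> w [].
    move=> n n0 Xn.
    have exn : exists n, X n.+1 w == o by exists n.-1; rewrite prednK//; apply/eqP.
    case: (ex_minnP exn) => m /eqP Xm minm; exists m => //; split => // i im.
    by rewrite add1n => /= /eqP /minm; rewrite leqNgt im.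
  by move=> n _ [_ Xn]; exists n.+1.
rewrite -(prob_start (walk o)); last exact: (measurable_ever_hit _ _ _ o).
rewrite (prob_step o [::]); last exact: (measurable_ever_hit _ _ _ o).
move=> sum1; apply: EFin_inj; rewrite -sum1 /avg -sumEFin; apply: eq_bigr => z _.
rewrite (prob_ever_hit _ [:: o])//; have [_ _ chain] := walk o.
by rewrite (chain [::]) (prob_segment1 (walk o)) eqxx mul1e.
Qed.

(** * Leaving a finite set before the root, and the Green function *)

Section ExitBeforeRoot.
Variables (o : V) (D : set V).
Hypotheses (Do : D o) (finD : finite_set D).

Definition exit_event : set Omega :=
  [set w | (hitting_time R X (~` D) w < hitting_time R X [set o] w)%E].

Let SB : (D `\ o) `&` ~` D = set0.
Proof. by apply/seteqP; split => x // [[Dx _] /(_ Dx)]. Qed.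

Lemma exit_eventE : exit_event = \bigcup_n hit_event (D `\ o) (~` D) n 0.
Proof.
apply/seteqP; split=> w.
  move=> /hitting_time_lt[n [nDn Din no]]; exists n => //; split => // i ilt.
  split; first by apply: contrapT; exact: Din.
  by apply: no; exact: ltnW.
move=> [n _ [Din nDn]]; apply/hitting_time_lt; exists n; split => //.
  by move=> i /Din[Di _]; apply.
move=> i; rewrite leq_eqVlt => /predU1P[->|/Din[_]//].
by move=> /= Xo; apply: nDn; rewrite add0n Xo.
Qed.

Lemma prob_exit_event x : P x exit_event = (exit_prob N o D x)%:E.
Proof.
rewrite exit_eventE -(prob_start (walk x)); last exact: (measurable_ever_hit _ _ _ x).
by rewrite (prob_ever_hit x [::])// (prob_segment1 (walk x)) eqxx mul1e.
Qed.

(** A path in [D] off [o] leaves the exit event undecided, so only the future of its last vertex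
    counts. This is the Doob transform by [exit_prob] at the level of paths. *)
Lemma prob_segment_exit x s y : (forall z, z \in rcons s y -> (D `\ o) z) ->
  P x (initial_segment X (rcons s y) `&` exit_event) =
  (P x (initial_segment X (rcons s y)) * (exit_prob N o D y)%:E)%E.
Proof.
move=> sub; rewrite -prob_ever_hit// exit_eventE; congr (P x _).
have inS w i : initial_segment X (rcons s y) w -> (i <= size s)%N -> (D `\ o) (X i w).
  move=> sw ile; rewrite (initial_segment_nth y sw) ?size_rcons//.
  by apply: sub; apply: mem_nth; rewrite size_rcons.
apply/seteqP; split=> w [sw [n _ [SE BE]]]; split => //.
  have sn : (size s <= n)%N.
    rewrite leqNgt; apply/negP => ns; apply: BE; rewrite add0n.
    by have [] := inS _ _ sw (ltnW ns).
  exists (n - size s)%N => //; split; last by rewrite subnKC.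
  by move=> i ilt; apply: (SE (size s + i)%N); rewrite -ltn_subRL.
exists (size s + n)%N => //; split => // i ilt; rewrite add0n.
have [/(inS _ _ sw)//|si] := leqP i (size s).
rewrite -(subnKC (ltnW si)); apply: SE.
by rewrite -(ltn_add2l (size s)) subnKC// ltnW.
Qed.

(** Such a path reaches [o] while still in [D], so it has probability 0 under the conditioning. *)
Lemma segment_exit_root s : (forall z, z \in s -> D z) -> o \in s ->
  initial_segment X s `&` exit_event = set0.
Proof.
move=> sub os; apply/seteqP; split=> // w [sw].
move=> /hitting_time_lt[n [nDn Din no]].
have ilt : (index o s < size s)%N by rewrite index_mem.
have Xo : X (index o s) w = o by rewrite (initial_segment_nth o sw)// nth_index.
have [/no/(_ Xo)//|ni] := leqP (index o s) n.
apply: nDn; rewrite (initial_segment_nth o sw) ?(ltn_trans ni)//.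
by apply: sub; apply: mem_nth; exact: ltn_trans ni ilt.
Qed.

Hypothesis flux : 0 < avg N (exit_prob N o D) o.

(** The expected number of visits to [o] and the function [W] below solve the same equation on the
    finite set [D] and vanish outside it; the maximum principle identifies them. *)
Lemma green_exit x : green N P X D x o =
  ((vcond N o)^-1 * ((1 - exit_prob N o D x) / avg N (exit_prob N o D) o))%:E.
Proof.
set q := exit_prob N o D; set c := avg N q o.
(* Here [1 - q y] is the probability of reaching [o] before leaving [D], and from [o] the number of
   visits is geometric with mean [c^-1], where [c] is the probability of leaving [D] before
   returning. *)
pose W y := c^-1 * (1 - q y).
have c0 : c != 0 by rewrite gt_eqF.
have avgW y : avg N W y = c^-1 * (1 - avg N q y) by rewrite avgZ avgB avg_cst.
have Wout y : ~ D y -> W y = 0 by move=> Dy; rewrite /W /q exit_prob_out// subrr mulr0.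
have WE y : \1_[set o] y + killed_avg N D W y = W y.
  rewrite indicE; have [Dy|nDy] := pselect (D y); last first.
    by rewrite killed_avgF// memNset ?addr0 ?Wout// => yo; apply: nDy; rewrite yo.
  rewrite killed_avgT// avgW; have [->|yo] := eqVneq y o.
    by rewrite mem_set//= /W /q exit_prob_root// -/q -/c; field.
  by rewrite memNset ?add0r /W -?exit_prob_harmonic//; exact/eqP.
have sup : supersolution N D [set o] W.
  split=> y; last by rewrite WE.
  rewrite mulr_ge0 ?invr_ge0 ?(ltW flux)// subr_ge0.
  by case/andP: (exit_prob_bounds N o D y).
have hitW y : hit N D [set o] y = W y.
  apply/le_anti; rewrite hit_le//=; have [Dy|nDy] := pselect (D y); last first.
    by rewrite Wout// (hit_ge0 sup).
  rewrite -subr_le0; apply: (max_principle (N := N) (S := D)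
      (f := fun y => W y - hit N D [set o] y)) => //.
    move=> z Dz; rewrite avgB -!(killed_avgT N _ Dz) -{1}WE {1}(hitE sup).
    by rewrite opprD addrACA subrr add0r.
  by move=> z t _ _ nDt; rewrite Wout// sub0r oppr_le0 (hit_ge0 sup).
rewrite /green EFinM; congr (_ * _)%E.
rewrite [RHS](_ : _ = (hit N D [set o] x)%:E); last by rewrite hitW /W mulrC.
rewrite -(hit_series x sup); apply: eq_eseriesr => k _.
rewrite -prob_hit_event0; congr (P x _); apply/seteqP; split=> w.
  move=> [Xo /hitting_time_gt kD]; split; last by rewrite add0n.
  by move=> i ilt; apply: contrapT; apply: kD; exact: ltnW.
move=> [Din Xo]; split=> //; apply/hitting_time_gt => i.
by rewrite leq_eqVlt => /predU1P[->|/Din Di]; [rewrite [X k w]Xo|]; apply.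
Qed.

Lemma hgreen_exit x :
  hgreen N P X o D x = (exit_prob N o D x / (vcond N o * avg N (exit_prob N o D) o))%:E.
Proof.
rewrite /hgreen !green_exit exit_prob_root// -EFinB; congr _%:E.
by field; rewrite !gt_eqF ?vcond_gt0.
Qed.

End ExitBeforeRoot.

End Walk.

(** * The h-process *)

Section HProcess.
Set Implicit Arguments.
Unset Strict Implicit.
Unset Printing Implicit Defensive.
Variables (R : realType) (V : choiceType) (N : network R V) (o : V).
Variables (d : measure_display) (Omega : measurableType d).
Variables (P : V -> probability Omega R) (X : nat -> Omega -> V).
Hypothesis walk : forall x, markov_chain (trans N) x (P x) X.
Variable h : V -> R.
Hypothesis pot : potential N o h.
Variables (v1 : posset h) (d' : measure_display) (Omega' : measurableType d').
Variables (Q : probability Omega' R) (Y : nat -> Omega' -> posset h).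
Hypothesis chain : markov_chain (@htrans R V N h) v1 Q Y.

Let Yval k w : V := val (Y k w).

(** Off the root [h] is nonnegative and harmonic, so at a zero of [h] all neighbours are zeros
    too. *)
Lemma potential_zero_step y z : y != o -> h y = 0 -> trans N y z * h z = 0.
Proof.
move=> yo hy; rewrite /trans; case: ifP => yz; last by rewrite mul0r.
rewrite (avg_eq0 (x := y) (N := N) (f := h)) ?mulr0//.
  by move=> u _; have [] := pot.
by rewrite (potential_avg pot yo) hy.
Qed.

Lemma hsegment_val (s : seq (posset h)) :
  initial_segment Yval (map val s) = initial_segment Y s.
Proof.
apply/seteqP; split=> w; rewrite /initial_segment /= size_map.
  rewrite (_ : mkseq _ _ = map val (mkseq (fun i => Y i w) (size s))).
    exact/inj_map/val_inj.
  by rewrite /mkseq -map_comp.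
by move=> {2}<-; rewrite /mkseq -map_comp.
Qed.

Lemma hsegment_outside s x : x \in s -> h x = 0 -> initial_segment Yval s = set0.
Proof.
move=> xs hx; apply/seteqP; split=> // w sw.
have := valP (Y (index x s) w).
rewrite -[val _]/(Yval (index x s) w) (initial_segment_nth x sw) ?index_mem//.
by rewrite nth_index// hx ltxx.
Qed.

Lemma posset_lift s : (forall x, x \in s -> 0 < h x) ->
  exists s' : seq (posset h), s = map val s'.
Proof.
elim: s => [|x s IH] pos; first by exists [::].
have [|s' ->] := IH; first by move=> y ys; apply: pos; rewrite inE ys orbT.
have hx : 0 < h x by apply: pos; rewrite mem_head.
by exists ((exist _ x hx : posset h) :: s').
Qed.

(** A path inside [posset h] lifts to a path of the chain; if [s] leaves it, both sides are 0. *)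
Lemma prob_hsegment_step s y z : 0 < h y -> 0 < h z ->
  Q (initial_segment Yval (rcons (rcons s y) z)) =
  (Q (initial_segment Yval (rcons s y)) * (trans N y z * h z / h y)%:E)%E.
Proof.
move=> hy hz; have [pos|] := pselect (forall x, x \in s -> 0 < h x).
  have [s' ->] := posset_lift pos.
  pose y' : posset h := exist _ y hy; pose z' : posset h := exist _ z hz.
  have y'E : rcons (map val s') y = map val (rcons s' y') by rewrite map_rcons.
  have z'E : rcons (rcons (map val s') y) z = map val (rcons (rcons s' y') z').
    by rewrite !map_rcons.
  by rewrite z'E y'E !hsegment_val; have [_ _ ->] := chain.
move=> /existsNP[x /not_implyP[xs /negP hx]].
have {}hx : h x = 0.
  by apply/eqP; rewrite eq_le leNgt hx; have [-> _ _ _] := pot.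
rewrite !(hsegment_outside (x := x))// ?measure0 ?mul0e//.
  by rewrite mem_rcons inE xs orbT.
by rewrite mem_rcons inE mem_rcons inE xs !orbT.
Qed.

(* Along a path that enters [h = 0] both sides vanish: there the walk can
   only get back to [h > 0] through the root. *)
Lemma prob_hsegment s y : o \notin rcons s y ->
  (Q (initial_segment Yval (rcons s y)) * (h (val v1))%:E =
   P (val v1) (initial_segment X (rcons s y)) * (h y)%:E)%E.
Proof.
have h0 x : 0 <= h x by have [] := pot.
elim/last_ind: s y => [|s y IH] z.
  move=> _; rewrite (prob_segment1 (walk _)).
  have [hz|] := ltP 0 (h z); last first.
    move=> hz; have {}hz : h z = 0 by apply/le_anti; rewrite hz h0.
    by rewrite hz mule0 (hsegment_outside (mem_head z [::]) hz) measure0 mul0e.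
  pose z' : posset h := exist _ z hz.
  rewrite -[rcons [::] z]/(map val [:: z']) hsegment_val (prob_segment1 chain).
  rewrite -val_eqE /=; case: eqVneq => [->//|_]; by rewrite !mul0e.
rewrite mem_rcons inE negb_or => /andP[oz osy]; have {IH}IH := IH _ osy.
have [_ _ ->] := walk (val v1).
rewrite -muleA -EFinM; have [hz|] := ltP 0 (h z); last first.
  move=> hz; have {}hz : h z = 0 by apply/le_anti; rewrite hz h0.
  rewrite hz mulr0 mule0 (hsegment_outside (x := z)) ?measure0 ?mul0e//.
  by rewrite mem_rcons mem_head.
have [hy|] := ltP 0 (h y); last first.
  move=> hy; have {}hy : h y = 0 by apply/le_anti; rewrite hy h0.
  rewrite potential_zero_step//; last first.
    by apply: contraNneq osy => ->; rewrite mem_rcons mem_head.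
  rewrite mule0 (hsegment_outside (x := y)) ?measure0 ?mul0e//.
  by rewrite mem_rcons inE mem_rcons mem_head orbT.
rewrite prob_hsegment_step// -muleA (muleC (_%:E)) muleA IH -!muleA -EFinM.
by congr (_ * _%:E)%E; rewrite mulrC divfK// gt_eqF.
Qed.

End HProcess.

Theorem corollary2p11 (R : realType) (V : choiceType) (N : network R V) (o : V)
    (d : measure_display) (Omega : measurableType d)
    (P : V -> probability Omega R) (X : nat -> Omega -> V)
    (walk : forall x, markov_chain (trans N) x (P x) X)
    (rec : recurrent_chain P X)
    (bounded : bounded_resistances N)
    (h : V -> R) (pot : potential N o h) :
  exists D : nat -> set V,
    [/\ exhaustion o D,
        forall v, hgreen N P X o (D n) v @[n --> \oo] --> (h v)%:E
      & forall (v1 : posset h)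
          (d' : measure_display) (Omega' : measurableType d')
          (Q : probability Omega' R) (Y : nat -> Omega' -> posset h),
          markov_chain (@htrans R V N h) v1 Q Y ->
          forall gamma : seq V,
            cond_prob (P (val v1)) (initial_segment X gamma)
              [set w | (hitting_time R X (~` D n) w
                          < hitting_time R X [set o] w)%E] @[n --> \oo]
            --> fine (Q (initial_segment (fun k w => val (Y k w)) gamma))].
Proof.
have [D [exh flux limD]] := potential_exhaustion (recurrent_hit walk o rec) pot bounded.
have [finD Do subD coverD] := exh.
have {}flux : \forall n \near \oo, 0 < avg N (exit_prob N o (D n)) o.
  by apply: filterS flux => n; rewrite pmulr_rgt0// vcond_gt0.
have inD x : \forall n \near \oo, D n x.
  have [m _ Dm] : (\bigcup_n D n) x by rewrite coverD.
  exists m => // n /= /subnK <-; elim: (n - m)%N => // k IH; exact: subD.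
have inDs (s : seq V) : \forall n \near \oo, forall x, x \in s -> D n x.
  elim: s => [|x s IH]; first exact: nearW.
  near=> n => y; rewrite inE => /predU1P[->|]; first by near: n; exact: inD.
  by move: y; near: n.
exists D; split=> // [v|v1 d' Omega' Q Y chain gamma].
  (* Positive flux, available for large [n], makes [hgreen] finite and equal to the quotient in
     [limD]. *)
  apply/cvg_EFin.
    by apply: filterS flux => n fl; rewrite (hgreen_exit walk).
  apply: cvg_trans (limD v); apply: near_eq_cvg; near=> n.
  by rewrite /= (hgreen_exit walk)//; near: n.
pose a n := vcond N o * avg N (exit_prob N o (D n)) o.
have h1 : 0 < h (val v1) by exact: svalP v1.
(* The quotients at [v1] tend to [h (val v1) > 0], so eventually the conditioning event has positive
   probability and [cond_prob] does not take its default value 0. *)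
have exit1 : \forall n \near \oo, exit_prob N o (D n) (val v1) != 0.
  have pos : \forall n \near \oo, 0 < exit_prob N o (D n) (val v1) / a n.
    by apply: (cvgr_gt _ (limD (val v1))).
  by apply: filterS pos => n; apply: contraTneq => ->; rewrite mul0r ltxx.
(* Along a path through [o] both probabilities vanish: the [h]-process never visits [o], and the
   conditioning forbids it once [D n] contains the path. *)
have [og|og] := boolP (o \in gamma).
  have h_o : h o = 0 by have [] := pot.
  rewrite (hsegment_outside Y og h_o) measure0 /=; apply: cvg_near_cst; near=> n.
  rewrite /cond_prob segment_exit_root ?measure0 ?mul0r//.
  by near: n; exact: inDs.
case/lastP: gamma og => [_|s y osy].
  rewrite !initial_segment_nil probability_setT /=; apply: cvg_near_cst; near=> n.
  rewrite /cond_prob setTI (prob_exit_event walk (Do n)) /= divff//.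
  by near: n.
set p := P (val v1) (initial_segment X (rcons s y)).
have pE : p = (fine p)%:E by rewrite fineK// (prob_fin P (val v1) (measurable_walk_segment walk (val v1) _)).
have -> : fine (Q (initial_segment (fun k w => val (Y k w)) (rcons s y))) =
    fine p * (h y / h (val v1)).
  have := prob_hsegment walk pot chain osy; rewrite -/p pE -EFinM.
  case: (Q _) => [r [rE]| |] /=; last 2 first.
    by rewrite gt0_mulye ?lte_fin.
    by rewrite gt0_mulNye ?lte_fin.
  by rewrite mulrA -rE mulfK// gt_eqF.
(* The flux [a n] cancels between the two exit probabilities; inserting it makes each quotient
   converge by [limD]. *)
apply: cvg_trans (_ : fine p * ((exit_prob N o (D n) y / a n) /
    (exit_prob N o (D n) (val v1) / a n)) @[n --> \oo] --> _).
  apply: near_eq_cvg; near=> n.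
  rewrite /cond_prob (prob_segment_exit walk (Do n)); last first.
    move=> z zs; split; last by move=> zo; move: osy; rewrite -zo zs.
    by move: z zs; near: n; exact: inDs.
  rewrite (prob_exit_event walk (Do n)) -/p pE -EFinM /=.
  have a0 : a n != 0.
    rewrite /a mulf_neq0 ?gt_eqF ?vcond_gt0//; by near: n.
  have q0 : exit_prob N o (D n) (val v1) != 0 by near: n.
  by field; rewrite a0 q0.
apply: cvgM; first exact: cvg_cst.
by apply: cvgM => //; apply: cvgV => //; rewrite gt_eqF.
Unshelve. all: by end_near.
Qed.
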